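(* Consider the tokenized linear bandit (TLB) problem with horizon $T\ge 2$, maximal depth $L$, embedding dimension $d$ and noise bound $\sigma$. Suppose the utility function is monotone and has small single-level deviation, satisfies DDMC, and satisfies the norm-comparison assumption with constant $c\ge 0$ (all defined in the context). Let $\mathbf y_1,\dots,\mathbf y_T$ be the complete sequences output by the algorithm EOFUL run with confidence parameter $\delta\in(0,1)$. Then, with probability at least $1-\delta$, $$\sum_{t=1}^T\Big(\max_{\mathbf z} u(x_t,\mathbf z)-u(x_t,\mathbf y_t)\Big)=O\Big(cL\sqrt{dT\big(\log T+\log(1/\delta)\big)}\Big),$$ where the maximum is over complete sequences $\mathbf z$ of length at most $L$. Consequently, with $\delta=1/T$, the expected regret of EOFUL satisfies $\mathrm{Reg}=O\big(cL\sqrt{dT\log T}\big)$. (Here $\sigma$, the regularization parameter $\lambda=\Theta(1)$ and the constant in the small single-level deviation assumption are treated as constants absorbed in $O(\cdot)$.)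
   Context: **Sequences.** $\mathcal V$ is a finite token set, $|\mathcal V|=n$, containing a special token $\mathrm{EOS}$. For a finite token sequence $\mathbf y$, $|\mathbf y|$ is its length, $\mathbf y^{(i)}$ its $i$-th token, $\mathbf y^{(i:j)}$ its segment from the $i$-th to the $j$-th token inclusive, and $\mathbf y:\mathbf z$ denotes concatenation. A sequence is complete if its last token is $\mathrm{EOS}$. Algorithms output only complete sequences of length at most $L$ ($L$ is known). **TLB problem.** In each round $t\in[T]$ a query $x_t$ (a token sequence) arrives. The decision maker irrevocably chooses tokens one by one to build a complete sequence $\mathbf y_t$, $|\mathbf y_t|\le L$, and then observes the reward $r_t=u(x_t,\mathbf y_t)+\eta_t$, where $\eta_t$ is zero-mean random noise with $|\eta_t|\le\sigma$. The utility $u\ge 0$ is linearly realizable: $u(x,\mathbf y)=\langle\theta,e(x,\mathbf y)\rangle$ for all queries $x$ and token sequences $\mathbf y$, where $\theta\in\mathbb R^d$ is unknown, $\|\theta\|\le1$, and the embedding function $e$, with values in $\mathbb R^d$ and $\|e(\cdot)\|\le 1$, can be queried by the decision maker during the decoding process. The expected regret is $\mathrm{Reg}=\sum_{t=1}^T\mathbb E[\max_{\mathbf z}r_t(\mathbf z)]-\sum_{t=1}^T\mathbb E[r_t(\mathbf y_t)]$, where $r_t(\mathbf z)=u(x_t,\mathbf z)+\eta_t$ and $\mathbf z$ ranges over complete sequences of length at most $L$. **Monotone.** For each query, (i) appending further $\mathrm{EOS}$ tokens to a sequence ending in $\mathrm{EOS}$ does not change the utility; (ii) appending a non-$\mathrm{EOS}$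 token to a sequence ending in $\mathrm{EOS}$ can only decrease the utility. **Small single-level deviation (SSLD).** Let $\mathbf o$ be the optimal complete sequence in round $t$. For any sequence $\mathbf a$ that deviates from $\mathbf o$ for the first time at level $i$, $|u(x_t,\mathbf o^{(1:i)})-u(x_t,\mathbf a^{(1:i)})|\le\varepsilon$, with $\varepsilon=O(1/\sqrt T)$. **DDMC (diminishing distance with more commons).** For any two different finite sequences $\mathbf y,\mathbf z$ with $|\mathbf y|=|\mathbf z|$, any token $\tau\in\mathcal V$ and any query $x_t$: $|u(x_t,\mathbf y:\tau)-u(x_t,\mathbf z:\tau)|\le|u(x_t,\mathbf y)-u(x_t,\mathbf z)|$. **EOFUL.** Write $\mathbf v_t=e(x_t,\mathbf y_t)$. Let $\lambda=\Theta(1)$, $\Sigma_1=\lambda I$, $\Sigma_{t+1}=\Sigma_t+\mathbf v_t\mathbf v_t^\top$. Let $\beta_t=\sigma^2\big(2+4d\log(1+\tfrac{tL}{d})+8\log\tfrac4\delta\big)$, $\hat\theta_1=\vec 0$, and $\hat\theta_t=\Sigma_t^{-1}\sum_{i=1}^{t-1}r_i\mathbf v_i$ for $t\ge2$. Let $C_1=\{\vec 0\}$ and $C_t=\{\vartheta\in\mathbb R^d:(\vartheta-\hat\theta_t)^\top\Sigma_t(\vartheta-\hat\theta_t)\le\beta_t\}$ for $t\ge2$. In round $t$, after receiving $x_t$, start with the empty sequence $\mathbf y$; for at most $L-1$ steps choose the token $\tau^*$ attaining $\max_{\tau\in\mathcal V,\,\vartheta\in C_t}\langle\vartheta,e(x_t,\mathbf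 y:\tau)\rangle$ and replace $\mathbf y$ by $\mathbf y:\tau^*$, stopping as soon as $\tau^*=\mathrm{EOS}$. If $\mathrm{EOS}$ was not chosen in these $L-1$ steps, append $\mathrm{EOS}$. Output $\mathbf y_t=\mathbf y$, observe the reward $r_t$, and compute $\hat\theta_{t+1},C_{t+1}$. **Norm-comparison assumption.** There is $c\ge0$ such that for any complete sequence $\mathbf y$ with $|\mathbf y|=k$, any $l\le k$ and every round $t$, $\|e(x_t,\mathbf y^{(1:l)})\|_{\Sigma_t}\le c\,\|e(x_t,\mathbf y)\|_{\Sigma_t}$, where $\|v\|_A=\sqrt{v^\top Av}$. *)

(* Defs.v *)
From HB Require Import structures.
From mathcomp Require Import all_boot all_order all_algebra.
From mathcomp Require Import all_classical all_reals all_analysis.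

Set Implicit Arguments.
Unset Strict Implicit.
Unset Printing Implicit Defensive.

Import Order.TTheory GRing.Theory Num.Theory.

Local Open Scope classical_set_scope.
Local Open Scope ring_scope.

Section EuclideanGeometry.
Context {R : realType} {d : nat}.
Implicit Types (v w : 'cV[R]_d) (A : 'M[R]_d).

Definition dot v w : R := (v^T *m w) 0 0.

(* The library norm `|v| on matrices is the sup norm, hence this one. *)
Definition norm2 v : R := Num.sqrt (dot v v).

Definition quad A v : R := (v^T *m A *m v) 0 0.

Definition mnorm A v : R := Num.sqrt (quad A v).

End EuclideanGeometry.

Section TokenSequences.
Context {V : finType} (EOS : V).
Implicit Types s : seq V.

(* The empty sequence is not complete. *)
Definition complete s : bool := if s is a :: s' then last a s' == EOS else false.

(* Maximum of [f] over the complete sequences of length at most [L].  For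
   [0 < L] the default value [f [:: EOS]] is one of the values compared. *)
Definition max_complete {R : realType} (L : nat) (f : seq V -> R) : R :=
  \big[Order.max/f [:: EOS]]_(z : L.-bseq V | complete z) f z.

End TokenSequences.

(* In all that follows, the first [seq V] argument of a utility or an embedding
   is the query and the second one is the generated sequence. *)
Section Assumptions.
Context {R : realType} {V : finType} (EOS : V).
Implicit Types (u : seq V -> seq V -> R) (x y z a o : seq V).

Definition monotone_utility u : Prop := forall x y, complete EOS y ->
  (forall k, u x (y ++ nseq k EOS) = u x y) /\
  (forall tau, tau != EOS -> u x (rcons y tau) <= u x y).

Definition ddmc u : Prop := forall x y z tau, y <> z -> size y = size z ->
  `|u x (rcons y tau) - u x (rcons z tau)| <= `|u x y - u x z|.

Definition optimal u (L : nat) x o : Prop :=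
  [/\ complete EOS o, (size o <= L)%N &
      forall z, complete EOS z -> (size z <= L)%N -> u x z <= u x o].

(* Levels are counted from 1: the first difference is between the tokens of
   level [i.+1], which [nth] numbers [i]. *)
Definition ssld u (L : nat) (eps : R) x : Prop :=
  forall o a (i : nat), optimal u L x o -> (i < size o)%N -> (i < size a)%N ->
    take i o = take i a -> nth EOS o i <> nth EOS a i ->
    `|u x (take i.+1 o) - u x (take i.+1 a)| <= eps.

Definition norm_comparison {d : nat} (e : seq V -> seq V -> 'cV[R]_d)
    (A : 'M[R]_d) (c : R) x : Prop :=
  forall y (l : nat), complete EOS y -> (1 <= l <= size y)%N ->
    mnorm A (e x (take l y)) <= c * mnorm A (e x y).

End Assumptions.

(* Rounds are numbered from 1.  [v t] is the embedding of the sequence output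
   in round [t] and [r t] the reward observed in that round. *)
Section EOFUL.
Context {R : realType} {V : finType} (EOS : V) {d : nat}.
Variables (sigma lambda delta : R) (L : nat).

Definition Sigma (v : nat -> 'cV[R]_d) (t : nat) : 'M[R]_d :=
  lambda%:M + \sum_(1 <= s < t) v s *m (v s)^T.

Definition beta (t : nat) : R :=
  sigma ^+ 2 * (2 + 4 * d%:R * ln (1 + t%:R * L%:R / d%:R) + 8 * ln (4 / delta)).

(* [theta_hat v r 1 = 0], since the sum is empty. *)
Definition theta_hat (v : nat -> 'cV[R]_d) (r : nat -> R) (t : nat) : 'cV[R]_d :=
  invmx (Sigma v t) *m \sum_(1 <= s < t) r s *: v s.

Definition conf_set (v : nat -> 'cV[R]_d) (r : nat -> R) (t : nat) :
    set 'cV[R]_d :=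
  if t == 1%N then [set 0]
  else [set th | quad (Sigma v t) (th - theta_hat v r t) <= beta t].

(* [tau] attains the maximum, over tokens and over parameters in [C], of the
   estimated utility of the sequence [p] extended by one token. *)
Definition optimistic_token (e : seq V -> seq V -> 'cV[R]_d) (C : set 'cV[R]_d)
    (x p : seq V) (tau : V) : Prop :=
  exists2 th, C th & forall tau' th', C th' ->
    dot th' (e x (rcons p tau')) <= dot th (e x (rcons p tau)).

(* [decode e C x k p y]: with at most [k] token choices left, the current
   sequence [p] may be turned into the output [y] (ties are broken
   arbitrarily). *)
Fixpoint decode (e : seq V -> seq V -> 'cV[R]_d) (C : set 'cV[R]_d) (x : seq V)
    (k : nat) (p y : seq V) : Prop :=
  if k is k'.+1 then
    exists2 tau, optimistic_token e C x p tau &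
      if tau == EOS then y = rcons p EOS else decode e C x k' (rcons p tau) y
  else y = rcons p EOS.

Definition out_embedding (e : seq V -> seq V -> 'cV[R]_d)
    (x y : nat -> seq V) (t : nat) : 'cV[R]_d := e (x t) (y t).

Definition reward (u : seq V -> seq V -> R) (x y : nat -> seq V)
    (eta : nat -> R) (t : nat) : R := u (x t) (y t) + eta t.

(* [y] is a possible output of the algorithm over rounds 1, ..., [T] on the
   queries [x] and the noise [eta]. *)
Definition eoful_run (u : seq V -> seq V -> R) (e : seq V -> seq V -> 'cV[R]_d)
    (T : nat) (x y : nat -> seq V) (eta : nat -> R) : Prop :=
  forall t, (1 <= t <= T)%N ->
    decode e (conf_set (out_embedding e x y) (reward u x y eta) t)
      (x t) L.-1 [::] (y t).

End EOFUL.

Section Regret.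
Context {R : realType} {V : finType} (EOS : V).

Definition utility_regret (u : seq V -> seq V -> R) (L T : nat)
    (x y : nat -> seq V) : R :=
  \sum_(1 <= t < T.+1) (max_complete EOS L (u (x t)) - u (x t) (y t)).

(* Measurability with respect to the discrete sigma-algebra on the countable
   type [seq V]. *)
Definition random_seq {d0 : measure_display} {Omega : measurableType d0}
    (X : Omega -> seq V) : Prop := forall s, measurable (X @^-1` [set s]).

Definition expected_regret {d0 : measure_display} {Omega : measurableType d0}
    (P : probability Omega R) (u : seq V -> seq V -> R) (L T : nat)
    (x y : nat -> Omega -> seq V) (eta : nat -> Omega -> R) : \bar R :=
  (\sum_(1 <= t < T.+1)
      'E_P[fun w => max_complete EOS L (fun z => (u (x t w) z + eta t w)%R)]
   - \sum_(1 <= t < T.+1)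
      'E_P[fun w => (u (x t w) (y t w) + eta t w)%R])%E.

End Regret.

(* Main.v *)
Require Import Defs.
From HB Require Import structures.
From mathcomp Require Import all_boot all_order all_algebra.
From mathcomp Require Import all_classical all_reals all_analysis.
From mathcomp Require Import measurable_realfun ring lra.

Set Implicit Arguments.
Unset Strict Implicit.
Unset Printing Implicit Defensive.

Import Order.TTheory GRing.Theory Num.Theory.

Local Open Scope classical_set_scope.
Local Open Scope ring_scope.

(* Under SSLD and DDMC the regret bound holds pathwise, for every noise and
   every policy.  Padding by EOS, which changes no utility, gives a
   complete sequence [y] and an optimal sequence [o] length [L].  Passing from
   level [j] to level [j + 1], insert [o^(1:j) : y_(j+1)] between the two
   prefixes: SSLD bounds its distance to [o^(1:j+1)] by [eps], and DDMC bounds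
   its distance to [y^(1:j+1)] by the distance at level [j].  Each round thus
   costs at most [L eps = O(L / sqrt T)].  The factor [c] is harmless: applying
   the norm comparison with [l = k] forces [c >= 1] unless all complete
   sequences have zero embedding, in which case there is no regret. *)

(** * Euclidean inner product and positive definiteness of [Sigma] *)

Section DotProduct.
Context {R : realType} {d : nat}.
Implicit Types v w : 'cV[R]_d.

Lemma dotE v w : dot v w = \sum_i v i 0 * w i 0.
Proof. by rewrite /dot mxE; apply: eq_bigr => i _; rewrite mxE. Qed.

Lemma dot_ge0 v : 0 <= dot v v.
Proof. by rewrite dotE sumr_ge0 // => i _; rewrite -expr2 sqr_ge0. Qed.

Lemma dot_eq0 v : dot v v = 0 -> v = 0.
Proof.
rewrite dotE => /eqP; rewrite psumr_eq0 => [/allP v0|i _]; last first.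
  by rewrite -expr2 sqr_ge0.
apply/matrixP => i j; rewrite (ord1 j) mxE; apply/eqP.
by have := v0 i (mem_index_enum i); rewrite /= -expr2 sqrf_eq0.
Qed.

(** Sum [2ab <= a^2 + b^2] over the coordinates. *)
Lemma dot_le1 v w : norm2 v <= 1 -> norm2 w <= 1 -> dot v w <= 1.
Proof.
have sqn a : norm2 a <= 1 -> dot a a <= 1.
  by rewrite -[X in _ <= X]sqrtr1 ler_sqrt ?ltr01.
move=> /sqn v1 /sqn w1.
suff : dot v w *+ 2 <= dot v v + dot w w by rewrite mulr2n; lra.
rewrite !dotE -sumrMnl -big_split /=; apply: ler_sum => i _.
by rewrite -subr_ge0 (_ : _ - _ = (v i 0 - w i 0) ^+ 2) ?sqr_ge0 // expr2; lra.
Qed.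

(** Each rank-one summand of [Sigma] contributes the square of [w^T v_s], so the regularizer alone
    bounds the form from below. *)
Lemma quad_Sigma_ge (lambda : R) (v : nat -> 'cV[R]_d) t w :
  lambda * dot w w <= quad (Sigma lambda v t) w.
Proof.
rewrite /quad /Sigma mulmxDr mulmxDl mulmx_sumr mulmx_suml mxE summxE.
rewrite mul_mx_scalar -scalemxAl mxE lerDl sumr_ge0 // => s _.
have -> : w^T *m (v s *m (v s)^T) *m w = (w^T *m v s) *m (w^T *m v s)^T.
  by rewrite trmx_mul trmxK !mulmxA.
by rewrite mxE big_ord1 [X in _ * X]mxE -expr2 sqr_ge0.
Qed.

Lemma mnorm_Sigma_eq0 (lambda : R) (v : nat -> 'cV[R]_d) t w : 0 < lambda ->
  mnorm (Sigma lambda v t) w = 0 -> w = 0.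
Proof.
move=> l0 /eqP; rewrite /mnorm sqrtr_eq0 => q0.
apply/dot_eq0/eqP; rewrite eq_le dot_ge0 andbT.
by rewrite -(pmulr_rle0 _ l0) (le_trans (quad_Sigma_ge _ v t w)).
Qed.

End DotProduct.

(** * Maxima over complete sequences, and the shape of decoded outputs *)

Section CompleteSequences.
Context {R : realType} {V : finType} (EOS : V).
Implicit Types (y z o p : seq V).

Lemma complete_rcons p : Defs.complete EOS (rcons p EOS).
Proof. by case: p => [|a p] /=; rewrite ?last_rcons eqxx. Qed.

Lemma complete_size_gt0 y : Defs.complete EOS y -> (0 < size y)%N.
Proof. by case: y. Qed.

Lemma complete_pad y k : Defs.complete EOS y ->
  Defs.complete EOS (y ++ nseq k EOS).
Proof.
case: y => [//|a y] /= /eqP yE; rewrite last_cat yE.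
by elim: k => //= k ->.
Qed.

Lemma max_completeP (L : nat) (f : seq V -> R) : (0 < L)%N ->
  exists o, [/\ Defs.complete EOS o, (size o <= L)%N, max_complete EOS L f = f o
    & forall z, Defs.complete EOS z -> (size z <= L)%N -> f z <= f o].
Proof.
move=> L0.
have [ o [oc oL oE]] : exists o, [/\ Defs.complete EOS o, (size o <= L)%N
    & max_complete EOS L f = f o].
  rewrite /max_complete; elim/big_ind : _ => [|a b|z zc].
  (* The default value of the maximum is attained by an admissible sequence, as [0 < L]. *)
  - by exists [:: EOS]; split => //=.
  - by move=> [y1 [? ? ->]] [y2 [? ? ->]]; case: leP => _;
      [exists y2|exists y1].
  - by exists z; split => //; exact: size_bseq.
exists o; split => // z zc zL; rewrite -oE.
exact: (@le_bigmax_cond _ _ _ _ (Bseq zL)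
  (fun z' : L.-bseq V => Defs.complete EOS z') (fun z' : L.-bseq V => f z') zc).
Qed.

Lemma max_completeD (L : nat) (f : seq V -> R) (a : R) : (0 < L)%N ->
  max_complete EOS L (fun z => f z + a) = max_complete EOS L f + a.
Proof.
move=> L0.
have [ o [oc oL -> omax]] := max_completeP f L0.
have [ o' [oc' oL' -> omax']] := max_completeP (fun z => f z + a) L0.
by apply/eqP; rewrite eq_le omax' // andbT lerD2r omax.
Qed.

(** At most [k] chosen tokens follow [p], then possibly one forced [EOS]; [k = L.-1] and empty [p]
    give length at most [L]. *)
Lemma decode_complete d (e : seq V -> seq V -> 'cV[R]_d) C q k p y :
  Defs.decode EOS e C q k p y ->
  Defs.complete EOS y /\ (size y <= size p + k.+1)%N.
Proof.
elim: k p => [|k IH] p /=.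
  by move=> ->; rewrite complete_rcons size_rcons addn1.
case=> tau _; case: ifP => _ => [->|/IH[yc yk]].
  by rewrite complete_rcons size_rcons addnS ltnS leq_addr.
by split => //; rewrite size_rcons addSnnS in yk.
Qed.

End CompleteSequences.

(** * Regret of a single round from SSLD and DDMC *)

Section Deviation.
Context {R : realType} {V : finType} (EOS : V).
Variables (u : seq V -> seq V -> R) (L : nat) (eps : R) (q : seq V).
Hypothesis eps_ge0 : 0 <= eps.
Hypotheses (udev : ssld EOS u L eps q) (uddmc : ddmc u).

Lemma prefix_deviation o y j : optimal EOS u L q o -> size y = size o ->
  (j <= size o)%N -> `|u q (take j o) - u q (take j y)| <= j%:R * eps.
Proof.
move=> oopt yo; elim: j => [|j IH] jo; first by rewrite !take0 subrr normr0 mul0r.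
have {}IH := IH (ltnW jo).
have jy : (j < size y)%N by rewrite yo.
pose b := rcons (take j o) (nth EOS y j).
have ob : `|u q (take j.+1 o) - u q b| <= eps.
  (* Either [b] is the next prefix of [o], or it leaves [o] for the first time at level [j + 1],
     where SSLD applies. *)
  have [ab|ab] := eqVneq (nth EOS o j) (nth EOS y j).
    by rewrite /b -ab -take_nth // subrr normr0.
  have sj : size (take j o) = j by rewrite size_takel // ltnW.
  have sb : size b = j.+1 by rewrite /b size_rcons sj.
  have -> : b = take j.+1 b by rewrite -sb take_size.
  apply: udev => //; rewrite ?sb //.
    by rewrite /b -cats1 takel_cat ?sj // take_takel.
  by rewrite /b nth_rcons sj ltnn eqxx; exact/eqP.
have bY : `|u q b - u q (take j.+1 y)| <= j%:R * eps.
  rewrite /b (take_nth EOS jy).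
  (* DDMC only compares different sequences; equal prefixes give distance zero. *)
  have [->|/eqP ne] := eqVneq (take j o) (take j y).
    by rewrite subrr normr0 mulr_ge0.
  apply: (le_trans _ IH); apply: uddmc => //; by rewrite !size_takel // ltnW.
rewrite -natr1 mulrDl mul1r [leRHS]addrC.
by apply: le_trans (ler_distD (u q b) _ _) _; rewrite lerD.
Qed.

Lemma utility_gap y : (0 < L)%N -> monotone_utility EOS u ->
  Defs.complete EOS y -> (size y <= L)%N ->
  max_complete EOS L (u q) - u q y <= L%:R * eps.
Proof.
move=> L0 mono yc yL.
have [ o [oc oL -> omax]] := max_completeP EOS (u q) L0.
pose pad s := s ++ nseq (L - size s) EOS.
have size_pad s : (size s <= L)%N -> size (pad s) = L.
  by move=> sL; rewrite size_cat size_nseq subnKC.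
have u_pad s : Defs.complete EOS s -> u q (pad s) = u q s.
  by case/(mono q) => upad _; exact: upad.
(* SSLD speaks of every optimal sequence, hence also of the padded one, whose levels reach up to
   [L]. *)
have popt : optimal EOS u L q (pad o).
  split; first exact: complete_pad.
    by rewrite size_pad.
  by move=> z zc zL; rewrite u_pad // omax.
have := @prefix_deviation (pad o) (pad y) L popt.
rewrite !size_pad // => /(_ erefl (leqnn _)).
rewrite !take_oversize ?size_pad // !u_pad //.
by apply: le_trans; exact: ler_norm.
Qed.

End Deviation.

(** * The degenerate case [c < 1] *)

Section NormComparison.
Context {R : realType} {V : finType} (EOS : V) {d : nat}.
Variables (e : seq V -> seq V -> 'cV[R]_d) (lambda c : R).
Variables (v : nat -> 'cV[R]_d) (t : nat) (q : seq V).
Hypotheses (lambda_gt0 : 0 < lambda)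
  (enc : norm_comparison EOS e (Sigma lambda v t) c q).

(** With [l = size y] the assumption reads [m <= c * m] for the norm [m] of the embedding. *)
Lemma norm_comparison_lt1 y : c < 1 -> Defs.complete EOS y -> e q y = 0.
Proof.
move=> c1 yc; have := @enc y (size y) yc.
rewrite leqnn (complete_size_gt0 yc) take_size => /(_ isT) le_c.
apply: (@mnorm_Sigma_eq0 _ _ lambda v t) => //.
apply/eqP; rewrite eq_le {2}/mnorm sqrtr_ge0 andbT leNgt; apply/negP => m0.
by move: le_c; rewrite leNgt gtr_pMl ?c1.
Qed.

End NormComparison.

(** * Measurability and integrability of the rewards *)

Section DiscreteMeasurability.
Context {R : realType} {d0 : measure_display} {Omega : measurableType d0}.

(** A preimage under [f \o X] is a countable union of fibers of [X]. This applies to queries and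
    outputs, as [seq V] is countable. *)
Lemma countable_measurable_comp (I : countType) (X : Omega -> I) (f : I -> R) :
  (forall i, measurable (X @^-1` [set i])) -> measurable_fun setT (f \o X).
Proof.
move=> mX _ B _; rewrite setTI.
have -> : (f \o X) @^-1` B =
    \bigcup_i (X @^-1` [set i] `&` [set _ | B (f i)]).
  apply/seteqP; split => [w Bw|w [i _ [<-]]//].
  by exists (X w).
apply: countable_bigcupT_measurable => // i.
apply: measurableI; first exact: mX.
have [Bi|Bi] := pselect (B (f i)).
  by rewrite (_ : [set _ | _] = setT) //; apply/seteqP; split.
by rewrite (_ : [set _ | _] = set0) //; apply/seteqP; split.
Qed.

Lemma bounded_integrable (P : probability Omega R) (f : Omega -> R) (M : R) :
  measurable_fun setT f -> (forall w, `|f w| <= M) ->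
  P.-integrable setT (EFin \o f).
Proof.
move=> mf fM; apply: measurable_bounded_integrable => //.
  by apply: le_lt_trans (probability_le1 P measurableT) _; rewrite ltry.
exists M; split; first exact: num_real.
by move=> r Mr w _; apply: le_trans (ltW Mr).
Qed.

End DiscreteMeasurability.

(** The left side is of order [sqrt T], and [T >= 2] gives [D >= ln 2], so [sqrt (d T D)] dominates
    it up to the factor [1 / sqrt (ln 2)]. *)
Lemma rate_le {R : realType} (C0 c D : R) (T L d : nat) : (2 <= T)%N ->
  (0 < d)%N -> ln T%:R <= D -> 0 <= c ->
  T%:R * (c * L%:R * (`|C0| / Num.sqrt T%:R)) <=
    (`|C0| / Num.sqrt (ln 2) + 1) * (c * L%:R * Num.sqrt (d%:R * T%:R * D)).
Proof.
move=> T2 d0 TD c0.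
have T0 : 0 < T%:R :> R by rewrite ltr0n; exact: leq_trans T2.
have ln2 : 0 < ln 2 :> R by rewrite ln_gt0 // ltr1n.
have lnT : ln 2 <= ln T%:R :> R by rewrite ler_ln ?posrE ?ler_nat.
have D0 : 0 < D by lra.
have -> : T%:R * (c * L%:R * (`|C0| / Num.sqrt T%:R)) =
    `|C0| * (c * L%:R * Num.sqrt T%:R).
  rewrite -[X in X * (c * _ * _) = _](sqr_sqrtr (ltW T0)) expr2.
  have s0 : Num.sqrt T%:R != 0 :> R by rewrite sqrtr_eq0 -ltNge.
  by field.
have s2 : 0 < Num.sqrt (ln 2) :> R by rewrite sqrtr_gt0.
apply: (@le_trans _ _
  (`|C0| / Num.sqrt (ln 2) * (c * L%:R * Num.sqrt (d%:R * T%:R * D)))); last first.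
  by rewrite mulrDl lerDl mul1r !mulr_ge0 ?sqrtr_ge0.
rewrite -[leRHS]mulrA ler_wpM2l // mulrCA ler_wpM2l ?mulr_ge0 //.
rewrite mulrC ler_pdivlMr // -sqrtrM ?(ltW T0) // ler_sqrt; last first.
  by rewrite !mulr_ge0 // ltW.
have d1 : 1 <= d%:R :> R by rewrite ler1n.
rewrite (mulrC d%:R) -mulrA ler_pM2l //.
apply: (@le_trans _ _ D); first by lra.
by rewrite ler_peMl // ltW.
Qed.

Theorem theorem3p9 (R : realType) (sigma lambda_min lambda_max C0 : R)
    (hlambda_min : 0 < lambda_min) :
  exists2 K : R, 0 < K &
  forall (V : finType) (EOS : V) (T L d : nat)
    (u : seq V -> seq V -> R) (e : seq V -> seq V -> 'cV[R]_d) (theta : 'cV[R]_d)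
    (lambda eps c delta : R)
    (d0 : measure_display) (Omega : measurableType d0) (P : probability Omega R)
    (x y : nat -> Omega -> seq V) (eta : nat -> Omega -> R),
  (2 <= T)%N -> (0 < L)%N -> (0 < d)%N ->
  (* linearly realizable nonnegative utility *)
  norm2 theta <= 1 ->
  (forall q z, norm2 (e q z) <= 1) ->
  (forall q z, u q z = dot theta (e q z)) ->
  (forall q z, 0 <= u q z) ->
  lambda_min <= lambda <= lambda_max ->
  0 < delta < 1 ->
  (* queries, noise and outputs *)
  (forall t, (1 <= t <= T)%N -> random_seq (x t)) ->
  (forall t, (1 <= t <= T)%N -> random_seq (y t)) ->
  (forall t, (1 <= t <= T)%N -> measurable_fun setT (eta t)) ->
  (forall t w, (1 <= t <= T)%N -> `|eta t w| <= sigma) ->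
  (forall t, (1 <= t <= T)%N -> ('E_P[eta t] = 0)%E) ->
  (forall w, eoful_run EOS sigma lambda delta L u e T
               (x ^~ w) (y ^~ w) (eta ^~ w)) ->
  (* structural assumptions *)
  monotone_utility EOS u ->
  ddmc u ->
  eps <= C0 / Num.sqrt T%:R ->
  (forall t w, (1 <= t <= T)%N -> ssld EOS u L eps (x t w)) ->
  0 <= c ->
  (forall t w, (1 <= t <= T)%N ->
     norm_comparison EOS e
       (Sigma lambda (out_embedding e (x ^~ w) (y ^~ w)) t) c (x t w)) ->
  ((1 - delta)%:E <=
     P [set w | (utility_regret EOS u L T (x ^~ w) (y ^~ w) <=
                K * (c * L%:R *
                     Num.sqrt (d%:R * T%:R * (ln T%:R + ln delta^-1))))%R])%E /\
  (delta = T%:R^-1 ->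
   (expected_regret EOS P u L T x y eta <=
     (K * (c * L%:R * Num.sqrt (d%:R * T%:R * ln T%:R)))%R%:E)%E).
Proof.
(* The summand 1 keeps the constant positive when [C0 = 0]. *)
exists (`|C0| / Num.sqrt (ln 2) + 1).
  by rewrite ltr_wpDl // divr_ge0 ?sqrtr_ge0.
move=> V EOS T L d u e theta lambda eps c delta d0 Omega P x y eta T2 L0 dpos
  theta1 e1 uE u0 /andP[lmin _] /andP[delta0 delta1] mx my meta eta_bnd _ run
  mono uddmc epsC dev c0 enc.
set K := `|C0| / _ + 1.
have lambda0 : 0 < lambda by exact: lt_le_trans lmin.
have T1 : 1 <= T%:R :> R by rewrite ler1n; exact: leq_trans T2.
pose B := c * L%:R * (`|C0| / Num.sqrt T%:R).
have B0 : 0 <= B by rewrite !mulr_ge0 // invr_ge0 sqrtr_ge0.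
have yc t w : (1 <= t <= T)%N ->
    Defs.complete EOS (y t w) /\ (size (y t w) <= L)%N.
  by move=> /(run w t)/decode_complete; rewrite add0n prednK.
have round_regret t w : (1 <= t <= T)%N ->
    max_complete EOS L (u (x t w)) - u (x t w) (y t w) <= B.
  move=> tT; have [yct yL] := yc t w tT.
  have [c1|c1] := ltP c 1.
    have u_eq0 z : Defs.complete EOS z -> u (x t w) z = 0.
      move=> zc; rewrite uE (norm_comparison_lt1 lambda0 (enc t w tT) c1 zc).
      by rewrite /dot mulmx0 mxE.
    have [ o [oc _ -> _]] := max_completeP EOS (u (x t w)) L0.
    by rewrite !u_eq0 ?subr0.
  have eps'0 : 0 <= `|C0| / Num.sqrt T%:R by rewrite divr_ge0 ?sqrtr_ge0.
  (* [eps] is only bounded from above, whereas the deviation argument takes a nonnegative bound. *)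
  have dev' : ssld EOS u L (`|C0| / Num.sqrt T%:R) (x t w).
    move=> o a i oo io ia oa ne.
    apply: le_trans (dev t w tT o a i oo io ia oa ne) _.
    apply: le_trans epsC _.
    by rewrite ler_wpM2r ?invr_ge0 ?sqrtr_ge0 ?ler_norm.
  apply: le_trans (utility_gap eps'0 dev' uddmc L0 mono yct yL) _.
  by rewrite /B ler_wpM2r // ler_peMl.
split=> [|_].
  (* The bound holds at every outcome, so the event has probability 1. *)
  rewrite (_ : [set w | _] = setT).
    by rewrite probability_setT lee_fin; lra.
  apply/seteqP; split => // w _ /=.
  apply: (@le_trans _ _ (T%:R * B)); last first.
    apply: rate_le => //; rewrite lerDl ln_ge0 //.
    by rewrite invf_ge1 // ltW.
  rewrite /utility_regret (_ : T%:R * B = \sum_(1 <= t < T.+1) B).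
    by apply: ler_sum_nat => t tT; exact: round_regret.
  by rewrite sumr_const_nat subn1 mulr_natl.
have u1 q z : `|u q z| <= 1 by rewrite ger0_norm // uE dot_le1.
have max1 q : `|max_complete EOS L (u q)| <= 1.
  by have [ o [_ _ -> _]] := max_completeP EOS (u q) L0.
have int_max t : (1 <= t <= T)%N -> P.-integrable setT
    (EFin \o (fun w => max_complete EOS L (fun z => u (x t w) z + eta t w))).
  move=> tT; apply: (@bounded_integrable _ _ _ _ _ (1 + sigma)).
    under eq_fun do rewrite max_completeD //.
    apply: measurable_funD; last exact: meta.
    apply: (countable_measurable_comp (fun q => max_complete EOS L (u q))).
    exact: mx.
  move=> w; rewrite max_completeD // (le_trans (ler_normD _ _)) // lerD //.
  exact: eta_bnd.
have int_out t : (1 <= t <= T)%N -> P.-integrable setT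
    (EFin \o (fun w => u (x t w) (y t w) + eta t w)).
  move=> tT; apply: (@bounded_integrable _ _ _ _ _ (1 + sigma)).
    apply: measurable_funD; last exact: meta.
    (* Query and output form one random variable with countably many values. *)
    apply: (countable_measurable_comp (X := fun w => (x t w, y t w))
      (fun p => u p.1 p.2)) => -[a b].
    rewrite (_ : _ @^-1` _ = x t @^-1` [set a] `&` y t @^-1` [set b]).
      by apply: measurableI; [exact: mx|exact: my].
    by apply/seteqP; split => w /= [-> ->].
  by move=> w; rewrite (le_trans (ler_normD _ _)) // lerD // eta_bnd.
apply: (@le_trans _ _ (T%:R * B)%:E); last first.
  by rewrite lee_fin rate_le.
(* Moving the second sum across the inequality in the extended reals requires it to be finite. *)
rewrite /expected_regret leeBlDr; last first.
  apply/sum_fin_numP => t; rewrite mem_index_iota => tT _.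
  by rewrite unlock integrable_fin_num // int_out.
have -> : T%:R * B = \sum_(1 <= t < T.+1) B.
  by rewrite sumr_const_nat subn1 mulr_natl.
rewrite -sumEFin -big_split /= big_seq [leRHS]big_seq.
apply: lee_sum => t; rewrite mem_index_iota => tT.
(* [B] becomes the integral of a constant, so that the two sides can be compared pointwise. *)
rewrite !unlock -[B%:E]mule1 -(probability_setT P) -integral_cst //.
have int_B : P.-integrable setT (EFin \o cst B).
  exact: finite_measure_integrable_cst.
rewrite -integralD //; last exact: int_out.
apply: le_integral => //; first exact: int_max.
  by apply: integrableD => //; exact: int_out.
(* The noise is the same for all [z], so it leaves the maximum and cancels. *)
move=> w _; rewrite /= -EFinD lee_fin max_completeD // addrA lerD2r.
by rewrite -lerBlDr round_regret.
Qed.
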